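(* There is a universal constant $K>0$ such that the following holds. Let $F$ be a non-abelian free group of finite rank, let $\varphi_\alpha,\varphi_\beta\in Cal$, and let $\phi_\lambda$ be a Rolli quasimorphism of $F$. 1. If $\alpha$ and $\beta$ are supported on the same symmetric independent family $I$, then $[\delta^1\varphi_\alpha]\smile[\delta^1\varphi_\beta]=0\in H^4_b(F)$, with a primitive of $\delta^1\varphi_\alpha\smile\delta^1\varphi_\beta$ of norm at most $K\,\|\alpha\|_\infty\|\beta\|_\infty$. 2. If $\varphi_\alpha\in\ell^1_{Ind}$ and $\varphi_\beta\in\kappa(\ell^1)$, then $[\delta^1\varphi_\alpha]\smile[\delta^1\varphi_\beta]=0\in H^4_b(F)$, with a primitive of $\delta^1\varphi_\alpha\smile\delta^1\varphi_\beta$ of norm at most $K\, SInd_\alpha\cdot S\kappa_\beta$. 3. If $\varphi_\beta\in\kappa(\ell^1)$, then $[\delta^1\phi_\lambda]\smile[\delta^1\varphi_\beta]=0\in H^4_b(F)$, with a primitive of $\delta^1\phi_\lambda\smile\delta^1\varphi_\beta$ of norm at most $K\,\|\lambda\|_\infty\cdot S\kappa_\beta$. 4. If $\varphi_\alpha\in\ell^1_{Ind}$ and $\varphi_\beta\in\kappa(c_0)$, then $[\delta^1\varphi_\alpha]\smile[\delta^1\varphi_\beta]\in H^4_b(F)$ has vanishing Gromov seminorm. 5. If $\varphi_\beta\in\kappa(c_0)$, then $[\delta^1\phi_\lambda]\smile[\delta^1\varphi_\beta]\in H^4_b(F)$ has vanishing Gromov seminorm.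
   Context: Bounded cohomology. $C^n_b(F)$ is the space of bounded functions $F^n\to\mathbb{R}$ with the sup norm ($C^0_b=\mathbb{R}$). The coboundary is $\delta^n f(g_1,\dots,g_{n+1})=f(g_2,\dots,g_{n+1})+\sum_{i=1}^n(-1)^i f(g_1,\dots,g_ig_{i+1},\dots,g_{n+1})+(-1)^{n+1}f(g_1,\dots,g_n)$ ($\delta^0=0$), defined also on unbounded functions; $H^n_b(F)=\ker(\delta^n|_{C^n_b})/\delta^{n-1}(C^{n-1}_b(F))$, with quotient seminorm called the Gromov seminorm. The cup product is induced by $(f\smile f')(g_1,\dots,g_{n+m})=f(g_1,\dots,g_n)f'(g_{n+1},\dots,g_{n+m})$. For a map $\varphi:F\to\mathbb{R}$, $\delta^1\varphi(g,h)=\varphi(g)+\varphi(h)-\varphi(gh)$; $\varphi$ is a quasimorphism if $\delta^1\varphi$ is bounded, and then $[\delta^1\varphi]\in H^2_b(F)$. A primitive of a coboundary $f\in\delta^3(C^3_b(F))$ is a $\pi\in C^3_b(F)$ with $\delta^3\pi=f$; its norm is $\|\pi\|_\infty$. Words. $F$ has a fixed basis $S=\{s_1,\dots,s_n\}$; elements are reduced words, $|w|$ is word length, and a product is reduced if there is no cancellation. $w$ is a subword of $g$ if $g=uwv$ as a reduced product; it is proper if $w\ne g$. Words $w_1,w_2$ overlap properly if, for some $i\in\{1,2\}$, $w_i=xy$ and $w_{3-i}=yz$ as reduced products with $x,y,z\neq1$; they overlap if they overlap properly or one is a proper subword of the other. $w$ is self-overlapping if it overlaps itself; $\mathcal{N}$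 is the set of non-self-overlapping words. For $w\in\mathcal N$, $w\neq 1$, the Brooks quasimorphism is $h_w(g)=$ (number of occurrences of $w$ as a subword of $g$) $-$ (number of occurrences of $w^{-1}$). A family $I\subset F$ is independent if no two words in $I$ overlap (so in particular all its words are non-self-overlapping), symmetric if $I=I^{-1}$. Coefficients. $\alpha,\beta:F\to\mathbb{R}$ are alternating ($\alpha_{w^{-1}}=-\alpha_w$) and supported on $\mathcal N$. With $\mathcal N^+\subset\mathcal N$ containing exactly one of $w,w^{-1}$ for each $1\ne w\in\mathcal N$, $\varphi_\alpha:=\sum_{w\in\mathcal N^+}\alpha_wh_w$ (pointwise a finite sum, independent of the choice of $\mathcal N^+$). Compatible families. For $uv$ a reduced product, write $w\in j(u|v)$ if $u=xu'$, $v=v'y$, $w=u'v'$ as reduced products with $u',v'\ne1$. A family $C$ of words is compatible if there is such $u|v$ with $w\in j(u|v)$ for all $w\in C$ (for infinite $C$, $u$ is allowed to be left-infinite and $v$ right-infinite). For $n\ge0$, $\kappa_\alpha(n):=\sup_C\sum_{w\in C,|w|>n}|\alpha_w|$ over all compatible families $C$. Spaces. $Cal=\{\varphi_\alpha:\kappa_\alpha(1)<\infty\}$ (this forces $\alpha$ to be bounded). $\kappa(c_0)=\{\varphi_\alpha:\kappa_\alpha(n)\to0\}$. $\kappa(\ell^1)=\{\varphi_\alpha: S\kappa_\alpha:=\sum_{n\ge0}\kappa_\alpha(n)<\infty\}$. $\ell^1_{Ind}$ is the set of $\varphi_\alpha$ such that $\alpha=\sum_{i\ge1}\alpha_i$ with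 each $\alpha_i$ bounded, alternating, supported on a symmetric independent family $I_i$, and $\sum_i\|\alpha_i\|_\infty<\infty$; $SInd_\alpha$ is the infimum of $\sum_i\|\alpha_i\|_\infty$ over all such expressions. Rolli quasimorphisms. For $\lambda=(\lambda_1,\dots,\lambda_n)$ with $\lambda_i:\mathbb{Z}\to\mathbb{R}$ bounded and alternating, $\phi_\lambda(g)=\sum_j\lambda_{i_j}(m_j)$, where $g=\prod_j s_{i_j}^{m_j}$ is the unique expression with $s_{i_j}\neq s_{i_{j+1}}$, $m_j\in\mathbb{Z}\setminus\{0\}$ ($\phi_\lambda(1)=0$). $\|\lambda\|_\infty=\max_i\|\lambda_i\|_\infty$. *)

(* Defs.v *)
From HB Require Import structures.
From mathcomp Require Import all_boot all_order all_algebra.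
From mathcomp Require Import all_classical all_reals all_analysis.
From mathcomp Require Import zify.

Set Implicit Arguments.
Unset Strict Implicit.
Unset Printing Implicit Defensive.

Import Order.TTheory GRing.Theory Num.Theory.
Import numFieldNormedType.Exports.

Local Open Scope classical_set_scope.
Local Open Scope ring_scope.

(* [(i, false)] stands for s_i and [(i, true)] for its inverse. *)
Definition letter (n : nat) := ('I_n * bool)%type.

Definition linv n (a : letter n) : letter n := (a.1, ~~ a.2).

Definition reduced n (s : seq (letter n)) : bool :=
  sorted (fun a b => b != linv a) s.

(* The free group of rank [n], with elements the reduced words. *)
Record fgroup (n : nat) := FWord {
  word :> seq (letter n);
  word_reduced : reduced word }.

HB.instance Definition _ n := [isSub for @word n].
HB.instance Definition _ n := [Countable of fgroup n by <:].

Section FreeGroup.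
Variable n : nat.
Implicit Types (a b : letter n) (s t u : seq (letter n)) (g h w : fgroup n).

(* Left multiplication of a reduced word by a letter. *)
Definition push a s : seq (letter n) :=
  if s is b :: s' then if b == linv a then s' else a :: s else [:: a].

Definition rmul s t : seq (letter n) := foldr push t s.

Definition rinv s : seq (letter n) := rev (map (@linv n) s).

Lemma linvK : involutive (@linv n).
Proof. by case=> i b; rewrite /linv /= negbK. Qed.

Lemma linv_neq a : linv a != a.
Proof. by case: a => i []; rewrite /linv xpair_eqE /= andbF. Qed.

Lemma reduced_behead a s : reduced (a :: s) -> reduced s.
Proof. exact: path_sorted. Qed.

Lemma push_reduced a s : reduced s -> reduced (push a s).
Proof.
case: s => [//|b s] rs; rewrite /push; case: eqP => [_|/eqP nba].
  exact: reduced_behead rs.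
by rewrite /reduced /= nba.
Qed.

Lemma push_cons a s : reduced (a :: s) -> push a s = a :: s.
Proof. by case: s => [//|b s] /= /andP[/negPf ->]. Qed.

Lemma pushVK a s : reduced s -> push a (push (linv a) s) = s.
Proof.
case: s => [|b s] rs /=; first by rewrite eqxx.
rewrite linvK; case: eqP => [ba|_]; last by rewrite /= eqxx.
by rewrite ba in rs *; rewrite push_cons.
Qed.

Lemma rmul_reduced s t : reduced t -> reduced (rmul s t).
Proof. by move=> rt; elim: s => //= a s; apply: push_reduced. Qed.

Lemma rmul_push a s t : reduced s -> reduced t ->
  rmul (push a s) t = push a (rmul s t).
Proof.
case: s => [//|b s] rs rt /=; case: eqP => [-> | //].
by rewrite pushVK // rmul_reduced.
Qed.

Lemma rmulA s t u : reduced t -> reduced u ->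
  rmul s (rmul t u) = rmul (rmul s t) u.
Proof.
by move=> rt ru; elim: s => //= a s ->; rewrite rmul_push // rmul_reduced.
Qed.

Lemma rmuls0 s : reduced s -> rmul s [::] = s.
Proof.
elim: s => //= a s IH rs.
by rewrite -/(rmul s [::]) IH ?push_cons //; apply: reduced_behead rs.
Qed.

Lemma rinv_reduced s : reduced s -> reduced (rinv s).
Proof.
rewrite /reduced /rinv rev_sorted sorted_map; apply: sub_sorted => a b /=.
by rewrite linvK eq_sym.
Qed.

Lemma rinvK : involutive rinv.
Proof.
by move=> s; rewrite /rinv map_rev revK -map_comp map_id_in // => a _; exact: linvK.
Qed.

Lemma rmulVs s : reduced s -> rmul (rinv s) s = [::].
Proof.
elim: s => //= a s IH rs.
rewrite /rinv /= rev_cons /rmul foldr_rcons /= linvK eqxx.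
exact/IH/reduced_behead/rs.
Qed.

Definition fone : fgroup n := @FWord n [::] isT.
Definition finvw g : fgroup n := FWord (rinv_reduced (word_reduced g)).
Definition fmul g h : fgroup n := FWord (rmul_reduced g (word_reduced h)).

Lemma fmulA : associative fmul.
Proof. by move=> x y z; apply: val_inj; rewrite /= rmulA ?word_reduced. Qed.

Lemma fmul1 : left_id fone fmul.
Proof. by move=> x; apply: val_inj. Qed.

Lemma fmulr1 : right_id fone fmul.
Proof. by move=> x; apply: val_inj; rewrite /= rmuls0 ?word_reduced. Qed.

Lemma fmulV : left_inverse fone finvw fmul.
Proof. by move=> x; apply: val_inj; rewrite /= rmulVs ?word_reduced. Qed.

Lemma fmulrV : right_inverse fone finvw fmul.
Proof.
move=> x; apply: val_inj => /=.
by rewrite -{1}(rinvK x) rmulVs // rinv_reduced ?word_reduced.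
Qed.

End FreeGroup.

HB.instance Definition _ n :=
  isGroup.Build (fgroup n) (@fmulA n) (@fmul1 n) (@fmulr1 n) (@fmulV n) (@fmulrV n).

Section Words.
Variable n : nat.
Local Notation F := (fgroup n).
Implicit Types (u v w x y z g : F) (I : set F).

(* A product [x * y] is reduced exactly when its underlying word is the
   concatenation [x ++ y]. *)

Definition proper_subword w g : bool := infix w g && (w != g).

Definition overlapl v w : Prop := exists x y z : F,
  [/\ x != 1%g, y != 1%g, z != 1%g, v = x ++ y :> seq _ & w = y ++ z :> seq _].

Definition overlap_properly v w : Prop := overlapl v w \/ overlapl w v.

Definition overlap v w : Prop :=
  [\/ overlap_properly v w, proper_subword v w | proper_subword w v].

Definition nonself : set F := [set w | ~ overlap w w].

Definition symmetric_family I : Prop := forall w, I w -> I w^-1%g.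

Definition independent I : Prop := forall v w, I v -> I w -> ~ overlap v w.

(* Number of positions at which [w] occurs in [g]. *)
Definition occ w g : nat :=
  \sum_(i < (size g).+1) prefix w (drop i g).

(* One representative of each pair [{w, w^-1}]; see [Npos_half]. *)
Definition Npos : set F :=
  [set w | nonself w /\ (pickle w < pickle w^-1%g)%N].

Lemma wordV g : word g^-1%g = rinv g. Proof. by []. Qed.

Lemma rinv_cat (s t : seq (letter n)) : rinv (s ++ t) = rinv t ++ rinv s.
Proof. by rewrite /rinv map_cat rev_cat. Qed.

Lemma nonselfV w : nonself w -> nonself w^-1%g.
Proof.
have subF v : proper_subword v v = false by rewrite /proper_subword eqxx andbF.
suff H v : overlapl v v -> overlapl v^-1%g v^-1%g.
  move=> nw; case; rewrite ?subF // => ov; apply: nw; constructor 1; left.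
  by rewrite -(invgK w); apply: H; case: ov.
move=> [x [y [z [x1 y1 z1 xy yz]]]].
exists z^-1%g, y^-1%g, x^-1%g; split; rewrite ?invg_eq1 //.
  by rewrite wordV yz rinv_cat.
by rewrite wordV xy rinv_cat.
Qed.

Lemma invg_neq w : w != 1%g -> w^-1%g != w.
Proof.
apply: contraNneq => /(congr1 (@word n)); rewrite wordV => e.
apply/eqP/val_inj => /=; apply/eqP; rewrite -size_eq0; apply/negPn/negP => s0.
have [a _] : exists a : letter n, true.
  by move: s0; case: (word w) => [//|a ?] _; exists a.
set s := word w in e s0 *.
have ev i : (i < size s)%N -> nth a s i = linv (nth a s (size s - i.+1)).
  move=> si; rewrite -{1}e /rinv nth_rev size_map // (nth_map a) //.
  by rewrite ltn_subrL /= lt0n.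
have rs : reduced s by exact: word_reduced.
have [sodd|seven] := boolP (odd (size s)).
  have /ev : ((size s)./2 < size s)%N by rewrite ltn_half_double -addnn; lia.
  have -> : (size s - (size s)./2.+1 = (size s)./2)%N.
    by rewrite -{1}(odd_double_half (size s)) sodd -addnn; lia.
  by move/esym/eqP; rewrite (negPf (linv_neq _)).
have [k sE] : exists k, size s = (k.+1 + k.+1)%N.
  have := odd_double_half (size s); rewrite (negPf seven) add0n -addnn.
  by case: (size s)./2 => [h|k <-]; [rewrite -h in s0 | exists k].
move: rs; rewrite /reduced => /(sortedP a)/(_ k).
rewrite (ev k) ?sE ?leq_addl ?addnK // linvK eqxx => H.
suff: (k.+1 < k.+1 + k.+1)%N by move/H.
by lia.
Qed.

Lemma Npos_half w : nonself w -> w != 1%g ->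
  (Npos w /\ ~ Npos w^-1%g) \/ (Npos w^-1%g /\ ~ Npos w).
Proof.
move=> nw w1; rewrite /Npos /= invgK; have := nonselfV nw.
have [lt|gt|/(pcan_inj pickleK)/esym/eqP] := ltngtP (pickle w) (pickle w^-1%g).
- by left; split=> // -[].
- by right; split=> // -[].
- by rewrite (negPf (invg_neq w1)).
Qed.

(* A finite or one-sided infinite sequence of letters. *)
Definition halfword := (seq (letter n) + (nat -> letter n))%type.

Definition hprefix (s : seq (letter n)) (h : halfword) : bool :=
  match h with
  | inl t => prefix s t
  | inr f => s == mkseq f (size s)
  end.

(* In [u|v] the left factor is read backwards, starting from the bar. *)
Definition reduced_cut (u v : halfword) : Prop :=
  forall s t, hprefix s u -> hprefix t v -> reduced (rev s ++ t).

Definition jset (u v : halfword) : set F :=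
  [set w | exists s t, [/\ s != [::], t != [::], hprefix s u, hprefix t v &
                         w = rev s ++ t :> seq _]].

Definition compatible (C : set F) : Prop :=
  exists u v : halfword, reduced_cut u v /\ C `<=` jset u v.

(* [(i, m)] stands for the power s_i^m. *)
Definition lsyl (a : letter n) : 'I_n * int := (a.1, if a.2 then -1 else 1).

Definition syl_word (p : 'I_n * int) : seq (letter n) :=
  nseq `|p.2|%N (p.1, p.2 < 0).

Fixpoint syllables (s : seq (letter n)) : seq ('I_n * int) :=
  if s is a :: s' then
    if syllables s' is p :: r then
      if p.1 == a.1 then (p.1, (lsyl a).2 + p.2) :: r
      else lsyl a :: p :: r
    else [:: lsyl a]
  else [::].

(* [syllables g] is the list of the exponents of the expression of [g] as a
   product of nonzero powers of generators, adjacent generators differing. *)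
Lemma syllablesP g :
  [/\ flatten (map syl_word (syllables g)) = g,
      all (fun p => p.2 != 0) (syllables g) &
      sorted (fun p q => p.1 != q.1) (syllables g)].
Proof.
have lw a : syl_word (lsyl a) = [:: a] by case: a => i [].
have l0 a : (lsyl a).2 != 0 by case: a => i [].
case: g => s /=; elim: s => [//|a s IH] rs.
have {IH} [] /= := IH (reduced_behead rs); rewrite -/(lsyl a).
case: (syllables s) => [|[i m] r] /=; first by move=> <-; rewrite lw l0.
move=> fs /andP[m0 ar] sr; case: eqP => [ia|/eqP nia]; last first.
  by rewrite /= lw fs l0 m0 ar sr /= eq_sym nia.
suff [sw m'0] : syl_word (i, (lsyl a).2 + m) = a :: syl_word (i, m) /\
                (lsyl a).2 + m != 0.
  by rewrite /= sw /= fs m'0 ar; split=> //; case: r sr {fs ar}.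
have : a.2 = (m < 0).
  move: rs; rewrite -fs /= /syl_word /=.
  case k: `|m|%N => [|k'] /=; first by move/eqP: k; rewrite absz_eq0 (negPf m0).
  case: a ia => i' b /= -> /andP[+ _].
  by rewrite /linv xpair_eqE eqxx /=; case: b; case: (m < 0).
case: a ia {rs} => i' b /= -> ->; rewrite /syl_word /=.
case: m m0 {fs sr} => [[//|m]|m] _ /=; split=> //.
Qed.

End Words.

Section BoundedCohomology.
Variables (R : realType) (G : groupType).

Definition supnorm (T : Type) (f : T -> R) : \bar R :=
  ereal_sup [set `|f x|%:E | x in setT].

Definition cochain (m : nat) := m.-tuple G -> R.

(* (g_0, ..., g_i g_(i+1), ..., g_m) *)
Definition merge m (i : 'I_m) (t : m.+1.-tuple G) : m.-tuple G :=
  [tuple if (j < i)%N then tnth t (widen_ord (leqnSn m) j)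
         else if j == i then
           (tnth t (widen_ord (leqnSn m) j) * tnth t (lift ord0 j))%g
         else tnth t (lift ord0 j) | j < m].

Definition coboundary m (f : cochain m) : cochain m.+1 := fun t =>
  f [tuple tnth t (lift ord0 j) | j < m]
  + \sum_(i < m) (-1) ^+ i.+1 * f (merge i t)
  + (-1) ^+ m.+1 * f [tuple tnth t (widen_ord (leqnSn m) j) | j < m].

Definition cup m k (f : cochain m) (f' : cochain k) : cochain (m + k) := fun t =>
  f [tuple tnth t (lshift k i) | i < m] * f' [tuple tnth t (rshift m j) | j < k].

Definition bcochain m : set (cochain m) := bounded_fun.
Definition bcocycle m : set (cochain m) :=
  [set f | bcochain f /\ coboundary f = 0].
Definition bcoboundary m : set (cochain m) :=
  if m is m'.+1 then @coboundary m' @` @bcochain m' else [set 0].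

(* Elements of H_b^m are the cosets [hclass f], for [f] a bounded cocycle. *)
Definition hclass m (f : cochain m) : set (cochain m) :=
  [set f' | bcoboundary (f' - f)].

(* The union over all representatives; for classes of cocycles it is a single
   coset, by the Leibniz rule. *)
Definition hcup m k (c : set (cochain m)) (c' : set (cochain k)) :
    set (cochain (m + k)) :=
  \bigcup_(p in c `*` c') hclass (cup p.1 p.2).

Definition gromov m (c : set (cochain m)) : \bar R :=
  ereal_inf [set supnorm f | f in c].

Definition cochain1 (phi : G -> R) : cochain 1 := fun t => phi (tnth t ord0).

Definition d1 (phi : G -> R) : cochain 2 := coboundary (cochain1 phi).

Lemma d1E phi g h : d1 phi [tuple g; h] = phi g + phi h - phi (g * h)%g.
Proof.
rewrite /d1 /coboundary /cochain1 big_ord1 !tnth_mktuple /= expr1 sqrrN expr1n.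
rewrite mul1r mulN1r addrAC [phi _ + phi _]addrC; congr (phi _ + phi _ - phi _).
Qed.

End BoundedCohomology.

Section Quasimorphisms.
Variables (R : realType) (n : nat).
Local Notation F := (fgroup n).
Implicit Types (a : F -> R).

Definition brooks (w g : F) : R := (occ w g)%:R - (occ w^-1%g g)%:R.

Definition alternating a : Prop := forall w, a w^-1%g = - a w.

Definition supported a (A : set F) : Prop := forall w, a w != 0 -> A w.

Definition coefficients a : Prop := alternating a /\ supported a (@nonself n).

Lemma finite_brooks (g : F) : finite_set [set w | brooks w g != 0].
Proof.
have occ0 (w : F) : ~~ infix w g -> occ w g = 0%N.
  move=> nwg; rewrite /occ big1 // => i _; apply/eqP; rewrite eqb0.
  apply: contra nwg => /prefixP[t e].
  by apply/infixP; exists (take i g), t; rewrite -e cat_take_drop.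
have fin : finite_set [set w : F | infix w g].
  pose l := [seq take j (drop i g) | i <- iota 0 (size g).+1,
                                     j <- iota 0 (size g).+1].
  apply: (@sub_finite_set _ _ (@word n @^-1` [set` l])).
    move=> w /= /infixP[u [v e]].
    have lu : (size u <= size g)%N by rewrite e size_cat leq_addr.
    have lw : (size w <= size g)%N by rewrite e !size_cat addnCA leq_addr.
    apply/allpairsP; exists (size u, size w).
    rewrite !mem_iota !add0n !ltnS; split=> //=.
    by rewrite e drop_size_cat // take_size_cat.
  apply: finite_preimage; last exact: finite_seq.
  by move=> x y _ _; exact: val_inj.
apply: (@sub_finite_set _ _ ([set w : F | infix w g] `|`
                             (fun w => w^-1%g) @` [set w : F | infix w g])).
  move=> w /= nz; have [wg|/occ0 w0] := boolP (infix w g); first by left.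
  have [wg|/occ0 w'0] := boolP (infix w^-1%g g).
    by right; exists w^-1%g => //; rewrite invgK.
  by move: nz; rewrite /brooks w0 w'0 subrr eqxx.
by rewrite finite_setU; split=> //; exact: finite_image.
Qed.

(* Finitely supported sum over [w], by [finite_brooks]. *)
Definition phi a (g : F) : R := \sum_(w \in @Npos n) (a w * brooks w g).

Definition kappa a (k : nat) : \bar R :=
  ereal_sup [set \esum_(w in C `&` [set w : F | (k < size w)%N]) `|a w|%:E
            | C in @compatible n].

Definition Skappa a : \bar R := (\sum_(0 <= k <oo) kappa a k)%E.

Definition ind_decomposition a (b : nat -> F -> R) : Prop :=
  [/\ forall i, bounded_fun (b i) /\ alternating (b i),
      forall i, exists I : set F,
        [/\ symmetric_family I, independent I & supported (b i) I],
      (\sum_(0 <= i <oo) supnorm (b i) < +oo)%E &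
      forall w, (\sum_(0 <= i < N) b i w) @[N --> \oo] --> a w].

Definition SInd a : \bar R :=
  ereal_inf [set (\sum_(0 <= i <oo) supnorm (b i))%E
            | b in ind_decomposition a].

Definition Cal : set (F -> R) :=
  [set phi a | a in [set a | coefficients a /\ (kappa a 1 < +oo)%E]].

Definition kappa_c0 : set (F -> R) :=
  [set phi a | a in [set a | coefficients a /\ kappa a k @[k --> \oo] --> 0%E]].

Definition kappa_l1 : set (F -> R) :=
  [set phi a | a in [set a | coefficients a /\ (Skappa a < +oo)%E]].

Definition l1_Ind : set (F -> R) :=
  [set phi a | a in [set a | coefficients a /\
                             exists b, ind_decomposition a b]].

Definition rolli_parameter (lam : 'I_n -> int -> R) : Prop :=
  forall i, bounded_fun (lam i) /\ forall m, lam i (- m) = - lam i m.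

Definition rolli (lam : 'I_n -> int -> R) (g : F) : R :=
  \sum_(p <- syllables g) lam p.1 p.2.

Definition rolli_norm (lam : 'I_n -> int -> R) : \bar R :=
  \big[maxe/0%E]_(i < n) supnorm (lam i).

End Quasimorphisms.

(* Main.v *)
Require Import Defs.
From mathcomp Require Import all_boot all_order all_algebra.
From mathcomp Require Import all_classical all_reals all_analysis.
From mathcomp Require Import zify ring lra.

Set Implicit Arguments.
Unset Strict Implicit.
Unset Printing Implicit Defensive.

Import Order.TTheory GRing.Theory Num.Theory.
Import numFieldNormedType.Exports.

Local Open Scope classical_set_scope.
Local Open Scope ring_scope.

(** The sum of Brooks quasimorphisms with coefficients [a] is the sum over all
    nonempty subwords of [g], taken with position, of [a].  Weighting the subword
    from position [i] to position [j] by the mean of the values of a function [f]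
    at the suffixes of [g] starting at [i] and at [j] gives a functional [T g f]
    with [T g 1 = phi a g].  Subwords are geodesic segments of the Cayley tree,
    and reversing a segment changes the sign of its contribution; hence on the
    tripod spanned by a product [g h] everything cancels in
    [T (g h) f - T g (f (. h)) - T h f] except the segments that run across the
    centre.  The words across a given point form a compatible family, so the
    total size of their coefficients is at most [kappa a 1]; at most one of them
    has a nonzero coefficient when the support is independent.
    For a bounded 2-cocycle [omega] put [eta (g, h) = T g (omega (., h))].  By the
    cocycle identity, [phi a cup omega + delta eta] at [(g, h, k)] equals the above
    expression for [f = omega (., k)], up to sign, so it is a bounded primitive
    of [delta (phi a) cup omega].  The same works for Rolli quasimorphisms, with
    syllables in place of subwords. *)

(** * Explicit coboundaries and cup products in low degree *)

Section LowDegreeCochains.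
Variables (R : realType) (G : groupType).

Lemma coboundary1E (f : cochain R G 1) (g h : G) :
  coboundary f [tuple g; h] = f [tuple h] - f [tuple (g * h)%g] + f [tuple g].
Proof.
rewrite /coboundary big_ord1 expr1 sqrrN expr1n mul1r mulN1r.
by congr (f _ - f _ + f _); apply/val_inj; rewrite /= enum_ordSl enum_ord0.
Qed.

Lemma coboundary2E (f : cochain R G 2) (g h k : G) :
  coboundary f [tuple g; h; k] =
  f [tuple h; k] - f [tuple (g * h)%g; k] + f [tuple g; (h * k)%g]
  - f [tuple g; h].
Proof.
rewrite /coboundary !big_ord_recl big_ord0 /= addr0 addrA.
rewrite [in LHS]/bump /= ?add1n !exprS expr0 !mulr1 !mulN1r opprK !mul1r !mulN1r.
by congr (f _ - f _ + f _ - f _); apply/val_inj; rewrite /= !enum_ordSl enum_ord0.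
Qed.

Lemma coboundary3E (f : cochain R G 3) (g h k l : G) :
  coboundary f [tuple g; h; k; l] =
  f [tuple h; k; l] - f [tuple (g * h)%g; k; l] + f [tuple g; (h * k)%g; l]
  - f [tuple g; h; (k * l)%g] + f [tuple g; h; k].
Proof.
rewrite /coboundary !big_ord_recl big_ord0 /= addr0 !addrA.
rewrite [in LHS]/bump /= ?add1n !exprS expr0 !mulr1 !mulN1r !opprK !mul1r.
rewrite ?mulN1r ?opprK ?mul1r.
by congr (f _ - f _ + f _ - f _ + f _); apply/val_inj;
  rewrite /= !enum_ordSl enum_ord0.
Qed.

Lemma cup22E (f f' : cochain R G 2) (g h k l : G) :
  cup f f' [tuple g; h; k; l] = f [tuple g; h] * f' [tuple k; l].
Proof.
by rewrite /cup; congr (f _ * f' _); apply/val_inj;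
  rewrite /= !enum_ordSl enum_ord0.
Qed.

Lemma tuple2P (t : 2.-tuple G) : exists g h, t = [tuple g; h].
Proof.
by case/tupleP: t => g t; case/tupleP: t => h t; exists g, h; rewrite (tuple0 t);
  apply/val_inj.
Qed.

Lemma tuple3P (t : 3.-tuple G) : exists g h k, t = [tuple g; h; k].
Proof.
case/tupleP: t => g t; case: (tuple2P t) => h [k ->].
by exists g, h, k; apply/val_inj.
Qed.

Lemma tuple4P (t : 4.-tuple G) : exists g h k l, t = [tuple g; h; k; l].
Proof.
case/tupleP: t => g t; case: (tuple3P t) => h [k [l ->]].
by exists g, h, k, l; apply/val_inj.
Qed.

End LowDegreeCochains.

(** * Evaluation of letter sequences and cancellation in products *)

Section Spelling.
Variable n : nat.
Local Notation F := (fgroup n).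
Implicit Types s t : seq (letter n).

(** Multiplying the letters out reduces the sequence on the way, so [spell] is total and
    multiplicative without side conditions on [s]. *)
Definition spell s : F := FWord (rmul_reduced s (isT : @reduced n [::])).

Lemma spell_word s : reduced s -> word (spell s) = s.
Proof. exact: rmuls0. Qed.

Lemma spellK (g : F) : spell g = g.
Proof. by apply/val_inj/spell_word/word_reduced. Qed.

Lemma spell_cat s t : spell (s ++ t) = (spell s * spell t)%g.
Proof.
apply/val_inj => /=; rewrite -rmulA ?rmul_reduced //=.
by rewrite /rmul foldr_cat.
Qed.

Lemma spell_rinv s : spell (rinv s) = (spell s)^-1%g.
Proof.
suff H : (spell (rinv s) * spell s)%g = 1%g by rewrite (canRL (mulgK _) H) mul1g.
elim: s => [|a s IH]; first by apply/val_inj.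
have -> : rinv (a :: s) = rinv s ++ [:: linv a].
  by rewrite /rinv map_cons rev_cons cats1.
rewrite spell_cat -(cat1s a) spell_cat mulgA -(mulgA (spell (rinv s))).
have -> : (spell [:: linv a] * spell [:: a])%g = 1%g.
  by apply/val_inj; rewrite /= linvK eqxx.
by rewrite mulg1.
Qed.

(** The word [c] is the part that cancels: [p], [c] and [q] are the legs of the tripod spanned by
    the product. Induction strips the last letter of [s] as long as it cancels the first one of
    [t]. *)
Lemma cancellation s t : reduced s -> reduced t ->
  exists p c q, [/\ s = p ++ c, t = rinv c ++ q & reduced (p ++ q)].
Proof.
elim/last_ind: s t => [|s a IH] t rs rt; first by exists [::], [::], t.
have rs' : reduced s.
  by move: rs; rewrite /reduced -cats1 => /cat_sorted2[].
case: t rt => [|b t] rt; first by exists (rcons s a), [::], [::]; rewrite !cats0.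
have [ba|nba] := eqVneq b (linv a).
  have [p [c [q [-> tE rpq]]]] := IH t rs' (reduced_behead rt).
  exists p, (rcons c a), q; split=> //; first by rewrite rcons_cat.
  by rewrite ba tE /rinv map_rcons rev_rcons.
exists (rcons s a), [::], (b :: t); rewrite cats0; split=> //.
rewrite /reduced cat_rcons; case: s rs {IH rs'} => [|c s] /=.
  by move=> _; rewrite nba; apply: rt.
by rewrite /reduced /= cat_path /= rcons_path nba => /andP[-> ->]; apply: rt.
Qed.

End Spelling.

(** * Functionals almost additive along products *)

Section QuasiCocycles.
Variables (R : realType) (n : nat).
Local Notation F := (fgroup n).
Implicit Types (T : F -> (F -> R) -> R) (f : F -> R) (g h k x : F).

(* [T g] integrates [f] along the geodesic from [g] to [1], a vertex of the
   geodesic being recorded as the corresponding suffix of [g]. *)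
Definition quasi_cocycle T (M : R) : Prop :=
  [/\ forall g c f f', T g (fun x => c * f x + f' x) = c * T g f + T g f',
      forall g f, T g^-1%g f = - T g (fun x => f (x * g^-1)%g) &
      forall g h f D, word (g * h)%g = g ++ h -> (forall x, `|f x| <= D) ->
        `|T (g * h)%g f - T g (fun x => f (x * h)%g) - T h f| <= M * D].

(** With [g = p c] and [h = c^-1 q], each of [g], [h] and [g h] is a reduced product of two legs and
    costs one error [M * D]. The two passages along [c] run in opposite directions and cancel by the
    inversion rule. *)
Lemma quasi_cocycle_additive T M g h f D : quasi_cocycle T M ->
  (forall x, `|f x| <= D) ->
  `|T (g * h)%g f - T g (fun x => f (x * h)%g) - T h f| <= 3 * M * D.
Proof.
move=> [_ Tinv Tadd] fD.
have [p [c [q [gE hE rpq]]]] := cancellation (word_reduced g) (word_reduced h).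
have gE' : g = (spell p * spell c)%g by rewrite -spell_cat -gE spellK.
have hE' : h = ((spell c)^-1 * spell q)%g.
  by rewrite -spell_rinv -spell_cat -hE spellK.
have [rp rc] : reduced p /\ reduced c.
  by move: (word_reduced g); rewrite gE /reduced => /cat_sorted2[].
have rq : reduced q.
  by move: (word_reduced h); rewrite hE /reduced => /cat_sorted2[].
have ghE : (g * h)%g = (spell p * spell q)%g.
  by rewrite gE' hE' mulgA mulgK.
have := Tadd (spell p) (spell c) (fun x => f (x * h)%g) D.
have := Tadd (spell c)^-1%g (spell q) f D.
have := Tadd (spell p) (spell q) f D.
rewrite -ghE -gE' -hE' -!spell_rinv !spell_word ?rinv_reduced //.
rewrite gE hE {1}ghE -spell_cat spell_word // spell_rinv.
move=> /(_ erefl fD) H1 /(_ erefl fD) H2 /(_ erefl (fun=> fD _)) H3.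
(* Since [c h = q], the leg [p] carries the same translate of [f] in [g] and in [g h]. *)
have e1 : (fun x => f ((x * spell c) * h)%g) = (fun x => f (x * spell q)%g).
  by apply/funext => x; rewrite hE' !mulgA mulgK.
move: H2; rewrite Tinv.
have -> : (fun x => f ((x * (spell c)^-1) * spell q)%g) =
          (fun x => f (x * h)%g).
  by apply/funext => x; rewrite hE' !mulgA.
move: H3; rewrite e1; move: H1.
rewrite !ler_norml => /andP[? ?] /andP[? ?] /andP[? ?]; apply/andP.
split; nra.
Qed.

End QuasiCocycles.

(** * Bounded cochains and the shape of the primitive *)

Section BoundedClasses.
Variables (R : realType) (G : groupType).
Implicit Types phi : G -> R.

Lemma bounded_funE (S : Type) (f : S -> R) :
  bounded_fun f <-> exists D, forall x, `|f x| <= D.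
Proof.
split=> [[M [_ HM]]|[D fD]].
  by exists (M + 1) => x; apply: HM => //; rewrite ltrDl.
exists D; split; first exact: num_real.
by move=> M DM x _; apply: le_trans (fD x) (ltW DM).
Qed.

Lemma coboundaryD m (f f' : cochain R G m) :
  coboundary (f + f') = coboundary f + coboundary f'.
Proof.
apply/funext => t; rewrite /coboundary !fctE /= mulrDr.
under eq_bigr do rewrite mulrDr.
by rewrite big_split /=; ring.
Qed.

Lemma coboundaryN m (f : cochain R G m) : coboundary (- f) = - coboundary f.
Proof.
apply/funext => t; rewrite /coboundary !fctE /= mulrN.
under eq_bigr do rewrite mulrN.
by rewrite sumrN; ring.
Qed.

Lemma coboundary0 m : coboundary (0 : cochain R G m) = 0.
Proof. by rewrite -(subrr 0) coboundaryD coboundaryN subrr. Qed.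

Lemma bcochain0 m : bcochain (0 : cochain R G m).
Proof. by apply/bounded_funE; exists 0 => t; rewrite normr0. Qed.

Lemma bcochainD m (f f' : cochain R G m) :
  bcochain f -> bcochain f' -> bcochain (f + f').
Proof.
move=> /bounded_funE[D fD] /bounded_funE[D' fD']; apply/bounded_funE.
by exists (D + D') => t; apply: le_trans (ler_normD _ _) (lerD (fD t) (fD' t)).
Qed.

Lemma bcochainN m (f : cochain R G m) : bcochain f -> bcochain (- f).
Proof.
move=> /bounded_funE[D fD]; apply/bounded_funE; exists D => t.
by rewrite [X in `|X|]/(- f t) normrN.
Qed.

Lemma d1_cocycle phi : coboundary (d1 phi) = 0.
Proof.
apply/funext => t; have [g [h [k ->]]] := tuple3P t.
by rewrite coboundary2E !d1E mulgA; transitivity (0 : R) => //; ring.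
Qed.

(** The first summand has the right coboundary but is unbounded in general; [coboundary eta] changes
    only its size, and [eta] is chosen later to make the sum bounded. *)
Definition perturbed_cup phi (omega eta : cochain R G 2) : cochain R G 3 :=
  cup (cochain1 phi) omega + coboundary eta.

Lemma perturbed_cupE phi omega eta g h k :
  perturbed_cup phi omega eta [tuple g; h; k] =
  phi g * omega [tuple h; k] +
  (eta [tuple h; k] - eta [tuple (g * h)%g; k] + eta [tuple g; (h * k)%g]
   - eta [tuple g; h]).
Proof.
rewrite /perturbed_cup fctE coboundary2E; congr (_ + _).
rewrite /cup /cochain1 tnth_mktuple; congr (phi _ * omega _).
by apply/val_inj; rewrite /= !enum_ordSl enum_ord0.
Qed.

(** This is the Leibniz rule together with [coboundary (coboundary eta) = 0]; the term [phi] cup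
    [coboundary omega] vanishes because [omega] is a cocycle. *)
Lemma coboundary_perturbed_cup phi omega eta : coboundary omega = 0 ->
  coboundary (perturbed_cup phi omega eta) = cup (d1 phi) omega.
Proof.
move=> w0; apply/funext => t; have [g [h [k [l ->]]]] := tuple4P t.
have : coboundary omega [tuple h; k; l] = 0 by rewrite w0.
rewrite coboundary2E => wE.
rewrite coboundary3E !perturbed_cupE (@cup22E R G) d1E !mulgA.
have {wE}-> : omega [tuple k; l] = omega [tuple (h * k)%g; l] -
  omega [tuple h; (k * l)%g] + omega [tuple h; k].
  by lra.
ring.
Qed.

End BoundedClasses.

(** * Construction of the primitive *)

Section CupVanishing.
Variables (R : realType) (n : nat).
Local Notation F := (fgroup n).
Variables (T : F -> (F -> R) -> R) (M : R).
Hypothesis TM : quasi_cocycle T M.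

(** The term [b] allows for other representatives of the first class. For [b = 0] the estimate
    bounds [p] itself; for bounded [b] it still shows that [p] is bounded. *)
Lemma cup_primitive (b : F -> R) (omega : cochain R F 2) D :
  coboundary omega = 0 -> (forall t, `|omega t| <= D) ->
  exists p : cochain R F 3,
    coboundary p = cup (d1 (fun g => T g (fun=> 1) + b g)) omega /\
    forall g h k, `|p [tuple g; h; k] - b g * omega [tuple h; k]| <= 3 * M * D.
Proof.
move=> w0 wD; have [Tlin _ _] := TM.
pose eta : cochain R F 2 := fun t =>
  T (tnth t ord0) (fun x => omega [tuple x; tnth t ord_max]).
have etaE g h : eta [tuple g; h] = T g (fun x => omega [tuple x; h]) by [].
exists (perturbed_cup (fun g => T g (fun=> 1) + b g) omega eta).
split=> [|g h k]; first exact: coboundary_perturbed_cup.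
rewrite perturbed_cupE !etaE.
have := quasi_cocycle_additive g h TM
  (f := fun x => omega [tuple x; k]) (fun=> wD _).
(* This is the cocycle identity of [omega] at [(x, h, k)], integrated over [x] by the linear
   functional [T g]. *)
suff -> : T g (fun x => omega [tuple (x * h)%g; k]) =
  omega [tuple h; k] * T g (fun=> 1) + T g (fun x => omega [tuple x; (h * k)%g])
  - T g (fun x => omega [tuple x; h]).
  rewrite -normrN; apply: le_trans; rewrite le_eqVlt; apply/orP; left.
  by apply/eqP; congr (`|_|); ring.
have := Tlin g (-1) (fun x => omega [tuple x; h])
  (fun x => omega [tuple h; k] + omega [tuple x; (h * k)%g]).
have := Tlin g (omega [tuple h; k]) (fun=> 1)
  (fun x => omega [tuple x; (h * k)%g]).
under [X in T g X = _]eq_fun do rewrite mulr1.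
move=> -> E; rewrite addrC -mulN1r -E; congr (T g); apply/funext => x.
have : coboundary omega [tuple x; h; k] = 0 by rewrite w0.
rewrite coboundary2E; lra.
Qed.

End CupVanishing.

(** * From primitives to cup products of classes *)

Section CupClass.
Variables (R : realType) (n : nat).
Local Notation F := (fgroup n).
Implicit Types (phi psi : F -> R).

Lemma gromov_hclass0 m : gromov (hclass (0 : cochain R F m)) = 0%E.
Proof.
apply/eqP; rewrite eq_le; apply/andP; split.
  apply: ge_ereal_inf; exists (supnorm (0 : cochain R F m)).
    exists 0 => //; rewrite /hclass /mkset subrr; case: m => [//|m] /=; exists 0.
      exact: bcochain0.
    exact: coboundary0.
  by apply: ge_ereal_sup => _ [t _ <-]; rewrite normr0.
apply: le_ereal_inf_tmp => _ [f _ <-]; apply: le_ereal_sup_tmp.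
by exists `|f [tuple 1%g | _ < m]|%:E; [exists [tuple 1%g | _ < m]|
  rewrite lee_fin].
Qed.

(** A bounded 1-cochain is a bounded function on the group, so changing the representative amounts
    to a bounded perturbation of [phi]. *)
Lemma hclass_d1 phi (f : cochain R F 2) : hclass (d1 phi) f ->
  exists b : F -> R, bounded_fun b /\ f = d1 (fun g => phi g + b g).
Proof.
move=> [b /bounded_funE[D bD] fE]; exists (fun g => b [tuple g]); split.
  by apply/bounded_funE; exists D => g.
rewrite -(subrK (d1 phi) f) -fE; apply/funext => t.
have [g [h ->]] := tuple2P t.
transitivity (coboundary b [tuple g; h] + d1 phi [tuple g; h]) => //.
by rewrite coboundary1E !d1E; ring.
Qed.

(** Since [hcup] is a union over all pairs of representatives, each pair needs its own bounded
    primitive, obtained from perturbations [b1] and [b2]. The norm bound concerns the unperturbed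
    pair only. *)
Lemma trivial_cup T M psi D : quasi_cocycle T M ->
  (forall g h, `|psi g + psi h - psi (g * h)%g| <= D) ->
  hcup (hclass (d1 (fun g => T g (fun=> 1)))) (hclass (d1 psi)) = hclass 0 /\
  exists p : cochain R F 3,
    [/\ bcochain p,
        coboundary p = cup (d1 (fun g => T g (fun=> 1))) (d1 psi) &
        (supnorm p <= (3 * M * D)%:E)%E].
Proof.
move=> TM psiD.
have [p [dp pb]] : exists p : cochain R F 3,
    coboundary p = cup (d1 (fun g => T g (fun=> 1))) (d1 psi) /\
    forall t, `|p t| <= 3 * M * D.
  have [||p [dp pb]] := @cup_primitive R n T M TM (fun=> 0) (d1 psi) D.
  - exact: d1_cocycle.
  - by move=> t; have [g [h ->]] := tuple2P t; rewrite d1E.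
  exists p; split=> [|t].
    by rewrite dp; congr (cup (d1 _) _); apply/funext => g; rewrite addr0.
  have [g [h [k ->]]] := tuple3P t.
  by have := pb g h k; rewrite mul0r subr0.
split; last first.
  exists p; split=> //; first by apply/bounded_funE; exists (3 * M * D).
  by apply: ge_ereal_sup => _ [t _ <-]; rewrite lee_fin.
apply/seteqP; split=> f.
  move=> [[p1 p2] [/= /hclass_d1[b1 [/bounded_funE[B1 bB1] ->]]]].
  move=> /hclass_d1[b2 [/bounded_funE[B2 bB2] ->]] [q bq qE].
  (* The defect of [psi + b2] involves three values of [b2]. *)
  pose D' := D + (B2 + B2 + B2).
  have psiD' t : `|d1 (fun g => psi g + b2 g) t| <= D'.
    have [g [h ->]] := tuple2P t; rewrite d1E.
    have -> : psi g + b2 g + (psi h + b2 h) - (psi (g * h)%g + b2 (g * h)%g) =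
      (psi g + psi h - psi (g * h)%g) + (b2 g + b2 h - b2 (g * h)%g) by ring.
    apply: le_trans (ler_normD _ _) (lerD (psiD _ _) _).
    apply: le_trans (ler_normB _ _) (lerD _ (bB2 _)).
    by apply: le_trans (ler_normD _ _) (lerD _ _).
  have [p' [dp' pb']] := @cup_primitive R n T M TM b1 _ D' (d1_cocycle _) psiD'.
  exists (q + p'); last by rewrite coboundaryD qE dp' subr0 subrK.
  apply: bcochainD => //; apply/bounded_funE; exists (3 * M * D' + B1 * D') => t.
  have [g [h [k ->]]] := tuple3P t.
  rewrite -[p' _](subrK (b1 g * d1 (fun g => psi g + b2 g) [tuple h; k])).
  apply: le_trans (ler_normD _ _) (lerD (pb' _ _ _) _).
  by rewrite normrM ler_pM.
rewrite /hclass /= subr0 => -[q bq qE].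
exists (d1 (fun g => T g (fun=> 1)), d1 psi).
  by split; rewrite /hclass /mkset subrr; exists 0; rewrite ?coboundary0 //;
    apply: bcochain0.
exists (q - p); last by rewrite coboundaryD coboundaryN qE dp.
apply: bcochainD => //; apply: bcochainN.
by apply/bounded_funE; exists (3 * M * D).
Qed.

End CupClass.

(** * Sums over the segments of an interval *)

Section TriangularSums.
Variable V : zmodType.
Implicit Types E : nat -> nat -> V.

Definition triangle N E : V := \sum_(0 <= i < N) \sum_(i.+1 <= j < N.+1) E i j.

Lemma eq_triangle N E E' : (forall i j, (i < j <= N)%N -> E i j = E' i j) ->
  triangle N E = triangle N E'.
Proof.
move=> EE'; rewrite /triangle; apply: eq_big_nat => i _; apply: eq_big_nat => j.
exact: EE'.
Qed.

(** Segments lie left of the point [m], right of it, or strictly across it. *)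
Lemma triangle_split m k E : triangle (m + k) E =
  triangle m E + triangle k (fun i j => E (m + i)%N (m + j)%N) +
  \sum_(0 <= i < m) \sum_(m.+1 <= j < (m + k).+1) E i j.
Proof.
rewrite {1}/triangle (big_cat_nat (n := m)) ?leq_addr //= [RHS]addrAC.
congr (_ + _); last first.
  rewrite -{1}(add0n m) big_addn addKn; apply: eq_bigr => i _.
  rewrite -addSn -addnS [(m + _)%N]addnC big_addn addnK.
  by apply: eq_bigr => j _; rewrite ![(m + _)%N]addnC.
rewrite -big_split; apply: eq_big_nat => i /= im.
by rewrite (big_cat_nat (n := m.+1)) // ltnS ?leq_addr // ltnW.
Qed.

Lemma triangle_rev N E :
  triangle N E = triangle N (fun i j => E (N - j)%N (N - i)%N).
Proof.
(* As a sum over pairs of ordinals, where the row [i = N] is empty, the reversal becomes a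
   reindexing by [rev_ord]. *)
have ord E' : triangle N E' =
    \sum_(i < N.+1) \sum_(j < N.+1 | (i < j)%N) E' i j.
  rewrite big_ord_recr /= [X in _ = _ + X]big_pred0 ?addr0; last first.
    by move=> j; apply/negbTE; rewrite -leqNgt -ltnS.
  rewrite /triangle big_mkord; apply: eq_bigr => i _.
  by rewrite (big_nat_widenl i.+1 0) // big_mkord; apply: eq_bigl => j.
rewrite !ord (reindex_inj rev_ord_inj) /=.
under eq_bigr => i _ do rewrite (reindex_inj rev_ord_inj) /=.
rewrite (exchange_big_dep xpredT) //=; apply: eq_bigr => i _.
apply: eq_big => [j|j _]; last by rewrite !subSS.
by rewrite !subSS; have := ltn_ord i; have := ltn_ord j; lia.
Qed.

End TriangularSums.

(** * The functional attached to a sum of Brooks quasimorphisms *)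

Section BrooksSums.
Variables (R : realType) (n : nat).
Local Notation F := (fgroup n).
Implicit Types (a : F -> R) (f : F -> R) (s t : seq (letter n)) (g h w x : F).

Definition slice s i j := take (j - i) (drop i s).

(** The mean over both ends keeps the weight unchanged when the segment is reversed. *)
Definition brooks_term a s f i j : R := a (spell (slice s i j)) *
  ((f (spell (drop i s)) + f (spell (drop j s))) / 2).

Definition brooks_sum a s f : R := triangle (size s) (brooks_term a s f).

(** The total coefficient mass of the subwords having position [m] strictly inside: the error made
    by cutting [s] there. *)
Definition crossing a s m : R :=
  \sum_(0 <= i < m) \sum_(m.+1 <= j < (size s).+1) `|a (spell (slice s i j))|.

Lemma brooks_sum_linear a s c f f' :
  brooks_sum a s (fun x => c * f x + f' x) =
  c * brooks_sum a s f + brooks_sum a s f'.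
Proof.
rewrite /brooks_sum /triangle mulr_sumr -big_split; apply: eq_bigr => i _ /=.
by rewrite mulr_sumr -big_split; apply: eq_bigr => j _ /=; rewrite /brooks_term; field.
Qed.

(** Subwords within [s] or within [t] cancel, a suffix of [s ++ t] that starts in [s] being a suffix
    of [s] translated by [t]. What remains crosses the cut, with weights at most [D]. *)
Lemma brooks_sum_cat a s t f D : (forall x, `|f x| <= D) ->
  `|brooks_sum a (s ++ t) f - brooks_sum a s (fun x => f (x * spell t)%g)
    - brooks_sum a t f| <= crossing a (s ++ t) (size s) * D.
Proof.
move=> fD; rewrite /brooks_sum size_cat triangle_split.
rewrite (@eq_triangle _ (size s) _ (brooks_term a s (fun x => f (x * spell t)%g)));
  last first.
  move=> i j /andP[ij js]; rewrite /brooks_term /slice -!spell_cat.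
  have drl k : (k <= size s)%N -> drop k (s ++ t) = drop k s ++ t.
    rewrite leq_eqVlt drop_cat => /orP[/eqP->|->] //.
    by rewrite ltnn subnn drop0 drop_size.
  rewrite !drl ?takel_cat ?size_drop ?leq_sub2r //.
  exact: ltnW (leq_trans ij js).
rewrite (@eq_triangle _ (size t) _ (brooks_term a t f)); last first.
  move=> i j _; rewrite /brooks_term /slice subnDl.
  by rewrite !drop_cat !ltnNge !leq_addr /= !addKn.
rewrite -[X in `|X|]addrA -opprD addrAC subrr add0r.
rewrite /crossing size_cat mulr_suml; apply: le_trans (ler_norm_sum _ _ _) _.
apply: ler_sum => i _; rewrite mulr_suml; apply: le_trans (ler_norm_sum _ _ _) _.
apply: ler_sum => j _; rewrite normrM ler_wpM2l // normrM.
rewrite [`|2^-1|]ger0_norm ?invr_ge0 // ler_pdivrMr //.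
apply: le_trans (ler_normD _ _) _; rewrite mulr_natr mulr2n.
exact: lerD.
Qed.

(** The inverse word runs through the same geodesic backwards, translated by the inverse of [s];
    each subword is inverted, which changes the sign of its coefficient. *)
Lemma brooks_sum_rinv a s f : Defs.alternating a ->
  brooks_sum a (rinv s) f =
  - brooks_sum a s (fun x => f (x * (spell s)^-1)%g).
Proof.
move=> alt.
have szr (u : seq (letter n)) : size (rinv u) = size u.
  by rewrite /rinv size_rev size_map.
rewrite /brooks_sum szr triangle_rev /triangle -sumrN; apply: eq_big_nat => i iN.
rewrite -sumrN; apply: eq_big_nat => j /andP[ij]; rewrite ltnS => jN.
have dropr k : drop k (rinv s) = rinv (take (size s - k) s).
  by rewrite /rinv drop_rev size_map map_take.
have spl k : (k <= size s)%N ->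
    spell (drop (size s - k) (rinv s)) = (spell (drop k s) * (spell s)^-1)%g.
  have sE : spell s = (spell (take k s) * spell (drop k s))%g.
    by rewrite -spell_cat cat_take_drop.
  by move=> ks; rewrite dropr subKn // spell_rinv sE invgM mulgA mulgV mul1g.
rewrite /brooks_term !spl // ?(leq_trans (ltnW ij)) //.
have -> : slice (rinv s) (size s - j) (size s - i) = rinv (slice s i j).
  rewrite /slice dropr subKn // /rinv take_rev size_map size_takel //.
  rewrite -map_drop take_drop subnK ?(ltnW ij) //.
  by congr (rev (map _ (drop _ _))); lia.
rewrite spell_rinv alt addrC; ring.
Qed.

End BrooksSums.

(** * The Brooks sum as a sum over positioned subwords *)

Section BrooksExpansion.
Variables (R : realType) (n : nat).
Local Notation F := (fgroup n).
Implicit Types (a : F -> R) (f : F -> R) (s t : seq (letter n)) (g h w x : F).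

Lemma word_slice g i j : word (spell (slice g i j)) = slice g i j.
Proof.
by apply: spell_word; apply: take_sorted; apply: drop_sorted; exact: word_reduced.
Qed.

Lemma size_slice s i j : (j <= size s)%N -> size (slice s i j) = (j - i)%N.
Proof. by move=> js; rewrite size_takel // size_drop leq_sub2r. Qed.

Lemma fgroup_eqE g h : (g == h) = (word g == word h).
Proof. by []. Qed.

Lemma fone_size w : (w == 1%g) = (size w == 0%N).
Proof. by rewrite size_eq0 fgroup_eqE. Qed.

Lemma occ_triangle w g : w != 1%g ->
  (occ w g)%:R = triangle (size g) (fun i j => (spell (slice g i j) == w)%:R) :> R.
Proof.
rewrite fone_size -lt0n => w0.
rewrite /occ big_ord_recr /= drop_size prefixs0 -size_eq0 -leqn0 leqNgt w0 addn0.
rewrite natr_sum /triangle big_mkord; apply: eq_bigr => i _.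
(* For a fixed start [i], only the end [j = i + size w] can spell [w]. *)
have -> : \sum_(i.+1 <= j < (size g).+1) (spell (slice g i j) == w)%:R =
    \sum_(i.+1 <= j < (size g).+1 | j == (i + size w)%N)
      (prefix w (drop i g))%:R :> R.
  rewrite [RHS]big_mkcond; apply: eq_big_nat => j /andP[ij jN].
  have szw : spell (slice g i j) = w -> j = (i + size w)%N.
    by move=> <-; rewrite word_slice size_slice //; lia.
  have [jE|jne] := eqVneq j (i + size w)%N; last first.
    by case: eqP => // /szw/eqP; rewrite (negPf jne).
  by rewrite fgroup_eqE word_slice /slice jE addKn prefixE.
have [p|_] := boolP (prefix w (drop i g)); last by rewrite big1.
rewrite -big_filter filter_pred1_uniq ?iota_uniq ?big_seq1 // mem_index_iota.
have := size_prefix p; rewrite size_drop leq_subRL ?(ltnW (ltn_ord i)) // ltnS => ->.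
by rewrite andbT -addn1 leq_add2l.
Qed.

Lemma sum_indicator (T : eqType) (r : seq T) (c : T -> R) y : uniq r ->
  \sum_(x <- r) c x * (y == x)%:R = if y \in r then c y else 0.
Proof.
move=> ur; case: ifPn => yr.
  rewrite (bigD1_seq y) //= eqxx mulr1 big1 ?addr0 // => x.
  by rewrite eq_sym => /negPf->; rewrite mulr0.
rewrite big_seq big1 // => x xr; case: eqP => [yx|_]; last by rewrite mulr0.
by rewrite yx xr in yr.
Qed.

Lemma coefficient1 a : Defs.alternating a -> a 1%g = 0.
Proof. by move=> /(_ 1%g); rewrite invg1; lra. Qed.

(** Each positioned subword [x] is counted once: by [w = x] if [x] lies in [Npos], and otherwise by
    [w = x^-1], where the sign of the Brooks count and the alternation of [a] compensate. *)
Lemma phiE a g : coefficients a -> phi a g = brooks_sum a g (fun=> 1).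
Proof.
move=> [alt supp].
(* The list [sl] contains all nonempty subwords of [g]; [r] lists the members of [Npos] for which
   the count in [g] can be nonzero. *)
pose sl := [seq spell (slice g i j) | i <- index_iota 0 (size g),
                                     j <- index_iota 0 (size g).+1].
pose r := [seq w <- undup (sl ++ map (fun w => w^-1%g) sl) | w \in @Npos n].
have ur : uniq r by rewrite filter_uniq // undup_uniq.
have Npos1 w : w \in @Npos n -> w != 1%g.
  by rewrite inE => -[_]; apply: contraTneq => ->; rewrite invg1 ltnn.
have memsl i j : (i < j <= size g)%N -> spell (slice g i j) \in sl.
  move=> /andP[ij jN]; apply: allpairs_f; rewrite mem_index_iota //.
  exact: leq_trans ij jN.
have occsl w : w != 1%g -> w \notin sl -> (occ w g)%:R = 0 :> R.
  move=> w1 wsl; rewrite occ_triangle // (@eq_triangle _ _ _ (fun _ _ => 0)).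
    by rewrite /triangle big1 // => i _; rewrite big1.
  by move=> i j /memsl; case: eqP => // -> wsl'; rewrite wsl' in wsl.
rewrite /phi (@fsbigE _ _ _ _ _ r) //; first last.
- move=> w Nw; have NW : w \in @Npos n by rewrite inE.
  have w1 := Npos1 _ NW.
  rewrite mem_filter NW mem_undup mem_cat negb_or => /andP[nw nw'].
  rewrite /brooks !occsl ?subrr ?mulr0 ?invg_eq1 //.
  by apply: contra nw' => w'; rewrite -(invgK w); apply: map_f.
- by move=> w /=; rewrite mem_filter => /andP[/[!inE]].
rewrite -big_filter (all_filterP (filter_all _ _)) -/r.
have -> : \sum_(w <- r) a w * brooks R w g = \sum_(w <- r) triangle (size g)
    (fun i j => a w * (spell (slice g i j) == w)%:R
              - a w * ((spell (slice g i j))^-1%g == w)%:R).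
  apply: eq_big_seq => w; rewrite mem_filter => /andP[/Npos1 w1 _].
  rewrite /brooks !occ_triangle ?invg_eq1 // mulrBr /triangle !mulr_sumr -sumrB.
  apply: eq_bigr => i _; rewrite !mulr_sumr -sumrB; apply: eq_bigr => j _.
  by rewrite (can2_eq (@invgK _) (@invgK _)).
rewrite /triangle exchange_big /=; apply: eq_big_nat => i iN.
rewrite exchange_big /=; apply: eq_big_nat => j /andP[ij jN].
have -> : brooks_term a g (fun=> 1) i j = a (spell (slice g i j)).
  by rewrite /brooks_term; field.
rewrite sumrB !sum_indicator //.
have xsl : spell (slice g i j) \in sl by apply: memsl; rewrite ij.
set x := spell _ in xsl *.
have xr : (x \in r) = (x \in @Npos n).
  by rewrite mem_filter mem_undup mem_cat xsl andbT.
have xr' : (x^-1%g \in r) = (x^-1%g \in @Npos n).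
  by rewrite mem_filter mem_undup mem_cat (map_f _ xsl) orbT andbT.
rewrite xr xr' alt; have [nx|nx] := pselect (nonself x).
  have [x1|x1] := eqVneq x 1%g.
    by rewrite x1 invg1 coefficient1 // if_same oppr0 if_same subrr.
  by case: (Npos_half nx x1) => -[p q]; rewrite (mem_set p) (memNset q); ring.
(* Self-overlapping words are outside the support of [a]. *)
have -> : a x = 0 by apply: contrapT => /eqP /supp.
by rewrite oppr0 !if_same subrr.
Qed.

End BrooksExpansion.

(** * Estimates for the words across a point *)

Section CrossingWords.
Variables (R : realType) (n : nat).
Local Notation F := (fgroup n).
Implicit Types (a : F -> R) (f : F -> R) (s t : seq (letter n)) (g h w x : F).

Lemma slice_cat s i j k : (i <= j <= k)%N ->
  slice s i k = slice s i j ++ slice s j k.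
Proof.
move=> /andP[ij jk]; rewrite /slice.
have -> : (k - i = (j - i) + (k - j))%N by lia.
by rewrite takeD drop_drop subnK.
Qed.

Lemma overlapC v w : overlap v w -> overlap w v.
Proof. by case=> [[]|?|?]; [constructor 1; right|constructor 1; left|constructor 3|constructor 2]. Qed.

Lemma overlap_slices g i j i' j' : (i < j <= size g)%N -> (i' < j' <= size g)%N ->
  (i <= i' < j)%N -> (i, j) != (i', j') ->
  overlap (spell (slice g i j)) (spell (slice g i' j')).
Proof.
move=> /andP[ij jN] /andP[ij' jN'] /andP[ii' i'j] ne.
have sub k l k' l' : (k <= k')%N -> (k' < l')%N -> (l' <= l)%N ->
    (l <= size g)%N -> (k, l) != (k', l') ->
    proper_subword (spell (slice g k' l')) (spell (slice g k l)).
  move=> kk' kl' ll' lN nekl; rewrite /proper_subword; apply/andP; split.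
    apply/infixP; exists (slice g k k'), (slice g l' l).
    rewrite !word_slice -slice_cat ?(ltnW kl') // -slice_cat //.
    by rewrite kk' (leq_trans (ltnW kl')).
  apply: contraNneq nekl => /(congr1 (fun w : F => size w)).
  rewrite !word_slice !size_slice ?(leq_trans ll') // => e.
  by rewrite xpair_eqE; lia.
(* The two segments are nested or, when [i < i' < j < j'], cut the word into three nonempty pieces
   with the middle one shared. *)
have [j'j|jj'] := leqP j' j; first by constructor 3; apply: sub.
have [ii|nii] := eqVneq i i'.
  by constructor 2; apply: sub => //; rewrite 1?eq_sym // ?ii // ltnW.
constructor 1; left.
exists (spell (slice g i i')), (spell (slice g i' j)), (spell (slice g j j')).
have i'N : (i' <= size g)%N by lia.
rewrite !fone_size !word_slice !size_slice // -!slice_cat //; try lia.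
by split=> //; lia.
Qed.

Definition crossers g m : seq (nat * nat) :=
  [seq (i, j) | i <- index_iota 0 m, j <- index_iota m.+1 (size g).+1].

Definition subword g (p : nat * nat) : F := spell (slice g p.1 p.2).

Lemma mem_crossers g m p : p \in crossers g m ->
  (p.1 < m < p.2)%N /\ (p.2 <= size g)%N.
Proof.
move=> /allpairsP[[i j] /= []]; rewrite !mem_index_iota.
by move=> /andP[_ im] /andP[mj jN] -> /=; rewrite im.
Qed.

Lemma crossers_uniq g m : uniq (crossers g m).
Proof. by apply: allpairs_uniq; rewrite ?iota_uniq // => -[? ?] [? ?] _ _. Qed.

(** Both segments contain [m] in their interior, so the one starting later starts before the other
    ends. *)
Lemma crossers_overlap g m p q : p \in crossers g m -> q \in crossers g m ->
  p != q -> overlap (subword g p) (subword g q).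
Proof.
move=> /mem_crossers[/andP[p1 p2] pN] /mem_crossers[/andP[q1 q2] qN].
have H r r' : (r.1 < m)%N -> (m < r.2 <= size g)%N ->
    (r'.1 < m)%N -> (m < r'.2 <= size g)%N -> (r.1 <= r'.1)%N -> r != r' ->
    overlap (subword g r) (subword g r').
  case: r r' => [i j] [i' j'] /= im /andP[mj jN] im' /andP[mj' jN'] ii' ne.
  by apply: overlap_slices => //; apply/andP; split=> //=; lia.
move=> pq; have [le|/ltnW le] := leqP p.1 q.1; first by apply: H => //; apply/andP.
by apply: overlapC; apply: H; rewrite 1?eq_sym //; apply/andP.
Qed.

Lemma crossingE a g m :
  crossing a g m = \sum_(p <- crossers g m) `|a (subword g p)|.
Proof. by rewrite big_allpairs. Qed.

Definition crossing_support a g m :=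
  [seq p <- crossers g m | a (subword g p) != 0].

Lemma crossing_supportE a g m :
  crossing a g m = \sum_(p <- crossing_support a g m) `|a (subword g p)|.
Proof.
rewrite crossingE big_filter [RHS]big_mkcond; apply: eq_bigr => p _.
by case: eqP => //= ->; rewrite normr0.
Qed.

(** Words across [m] overlap pairwise, so at most one of them has a nonzero coefficient. *)
Lemma crossing_independent a I g m : independent I -> supported a I ->
  ((crossing a g m)%:E <= supnorm a)%E.
Proof.
move=> indI supp; rewrite crossing_supportE.
have us : uniq (crossing_support a g m) by rewrite filter_uniq ?crossers_uniq.
have one p q : p \in crossing_support a g m -> q \in crossing_support a g m ->
    p = q.
  rewrite !mem_filter => /andP[/supp Ip cp] /andP[/supp Iq cq].
  by apply: contrapT => /eqP /(crossers_overlap cp cq); apply: indI.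
case: crossing_support us one => [|p [|q s]] us one.
- rewrite big_nil; apply: le_ereal_sup_tmp.
  by exists `|a 1%g|%:E; [exists 1%g | rewrite lee_fin].
- by rewrite big_seq1; apply: ereal_sup_ubound; exists (subword g p).
have e : p = q by apply: one; rewrite !inE eqxx ?orbT.
by move: us; rewrite e /= inE eqxx.
Qed.

(** The words across [m] lie in the compatible family of the cut of [g] at [m], and have length at
    least two, whence [kappa a 1]. *)
Lemma crossing_kappa a g m : coefficients a ->
  ((crossing a g m)%:E <= kappa a 1)%E.
Proof.
move=> [_ supp]; pose u := rev (take m g); pose v := drop m g.
have cuv : compatible (jset (inl u) (inl v)).
  exists (inl u), (inl v); split=> // s t /= /prefixP[s' us] /prefixP[t' vt].
  have := word_reduced g; rewrite -(cat_take_drop m g) -/v -(revK (take m g)) -/u.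
  by rewrite us vt rev_cat -catA => /cat_sorted2[_]; rewrite catA => /cat_sorted2[].
apply: le_trans (ereal_sup_ubound _); last by exists (jset (inl u) (inl v)).
rewrite crossing_supportE; set s := crossing_support a g m.
(* [kappa] counts words rather than positions. The same word at two crossing positions would overlap
   itself, so no word of the support is repeated. *)
have us : uniq (map (subword g) s).
  rewrite map_inj_in_uniq ?filter_uniq ?crossers_uniq // => p q.
  rewrite !mem_filter => /andP[/supp np cp] /andP[_ cq] e.
  apply: contrapT => /eqP /(crossers_overlap cp cq); rewrite -e; exact: np.
rewrite -(big_map (subword g) xpredT (fun w => `|a w|)) -sumEFin.
apply: esum_ge; exists [set` map (subword g) s]; last by rewrite fsbig_seq.
split; first exact: finite_seq.
move=> _ /= /mapP[[i j] + ->]; rewrite mem_filter.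
move=> /andP[_ /mem_crossers[/= ijm jN]].
move: (ijm) => /andP[im mj].
have mN : (m <= size g)%N by lia.
split; last first.
  change (1 < size (word (spell (slice g i j))))%N.
  by rewrite word_slice size_slice //; lia.
exists (rev (slice g i m)), (slice g m j); split.
- by rewrite -size_eq0 size_rev size_slice // subn_eq0 -ltnNge.
- by rewrite -size_eq0 size_slice // subn_eq0 -ltnNge.
- apply/prefixP; exists (rev (slice g 0 i)).
  rewrite -rev_cat -slice_cat ?(ltnW im) //.
  by rewrite /slice subn0 drop0.
- by rewrite /= /slice; exact: prefix_take.
by rewrite /subword revK -slice_cat ?word_slice // (ltnW im) (ltnW mj).
Qed.

(** [crossing] is a finite sum of absolute values, hence subadditive and compatible with the
    pointwise limit; each summand [b i] has independent support. *)
Lemma crossing_ind_decomposition a b g m : ind_decomposition a b ->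
  ((crossing a g m)%:E <= \sum_(0 <= i <oo) supnorm (b i))%E.
Proof.
move=> [_ indb bfin ba].
have sup0 i : (0 <= supnorm (b i))%E.
  by apply: le_ereal_sup_tmp; exists `|b i 1%g|%:E; [exists 1%g | rewrite lee_fin].
set S := (\sum_(0 <= i <oo) _)%E in bfin *.
have Sfin : S \is a fin_num.
  by rewrite ge0_fin_numE // nneseries_ge0.
rewrite -(fineK Sfin) lee_fin crossingE.
have cv : \sum_(p <- crossers g m) `|\sum_(0 <= i < N) b i (subword g p)|
    @[N --> \oo] --> \sum_(p <- crossers g m) `|a (subword g p)|.
  apply: cvg_big; first exact: add_continuous.
  by move=> p _; apply: cvg_norm; exact: ba.
rewrite -(cvg_lim _ cv) //; apply: limr_le; first by apply/cvg_ex; eexists; exact: cv.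
apply: nearW => N; rewrite -lee_fin fineK //.
apply: (@le_trans _ _ (\sum_(0 <= i < N) supnorm (b i))%E); last exact: nneseries_lim_ge.
apply: (@le_trans _ _ (\sum_(0 <= i < N) crossing (b i) g m)%:E).
  rewrite lee_fin; under [leRHS]eq_bigr do rewrite crossingE.
  by rewrite exchange_big /=; apply: ler_sum => p _; exact: ler_norm_sum.
rewrite -sumEFin; apply: lee_sum => i _.
by have [I [_ iI sI]] := indb i; exact: (crossing_independent g m iI sI).
Qed.

(** A common lower bound for the norms of the theorem, which allows one primitive to serve several
    of its parts. *)
Definition crossnorm a : \bar R :=
  ereal_sup [set (crossing a p.1 p.2)%:E | p in [set: F * nat]].

Lemma crossnorm_le a M : (forall g m, ((crossing a g m)%:E <= M)%E) ->
  (crossnorm a <= M)%E.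
Proof. by move=> H; apply: ge_ereal_sup => _ [p _ <-]. Qed.

Lemma crossnorm_ge0 a : (0 <= crossnorm a)%E.
Proof.
apply: le_ereal_sup_tmp; exists (crossing a (1%g : F) 0)%:E; first by exists (1%g, 0%N).
by rewrite lee_fin /crossing big_geq.
Qed.

Lemma brooks_quasi_cocycle a : Defs.alternating a -> crossnorm a \is a fin_num ->
  quasi_cocycle (fun g => brooks_sum a g) (fine (crossnorm a)).
Proof.
move=> alt fin; split=> [g c f f'|g f|g h f D gh fD].
- exact: brooks_sum_linear.
- by rewrite wordV brooks_sum_rinv // spellK.
rewrite gh; have := brooks_sum_cat a g h fD; rewrite spellK => /le_trans; apply.
apply: ler_wpM2r; first exact: le_trans (fD 1%g).
rewrite -gh -lee_fin fineK //; apply: ereal_sup_ubound.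
by exists ((g * h)%g, size g).
Qed.

(** Membership of [phi a] in [Cal] only provides some coefficients with finite [kappa]; injectivity
    identifies them with [a]. By induction on length, [phi a g] is [a g] plus coefficients of
    shorter words. *)
Lemma phi_inj a a' : coefficients a -> coefficients a' -> phi a = phi a' -> a = a'.
Proof.
move=> ca ca' e; apply/funext => g.
have [k] := ubnP (size g); elim: k => // k IH in g * => /ltnSE gk.
have [->|g1] := eqVneq g 1%g; first by
  rewrite (coefficient1 (proj1 ca)) (coefficient1 (proj1 ca')).
have := congr1 (@^~ g) e; rewrite /= !phiE // => /eqP; rewrite -subr_eq0 => /eqP.
have term c i j : brooks_term c g (fun=> 1) i j = c (spell (slice g i j)) :> R.
  by rewrite /brooks_term; field.
rewrite /brooks_sum /triangle -sumrB; under eq_bigr => i _.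
  rewrite -sumrB; under eq_bigr do rewrite !term.
  over.
have N0 : (0 < size g)%N by rewrite lt0n -fone_size.
have sm i j : (j <= size g)%N -> (j - i < size g)%N ->
    a (spell (slice g i j)) - a' (spell (slice g i j)) = 0.
  move=> jN ij; rewrite IH ?subrr // word_slice size_slice //.
  exact: leq_trans ij gk.
(* Isolates the pair [(0, size g)], the only one spelling [g] itself. *)
rewrite big_ltn //= big_nat_recr //= [X in X + _ + _]big_nat_cond big1; last first.
  by move=> j /andP[/andP[_ jN] _]; apply: sm; rewrite ?subn0 // ltnW.
rewrite [X in _ + _ + X]big_nat_cond big1; last first.
  move=> i /andP[/andP[i0 iN] _]; rewrite big_nat_cond big1 // => j.
  by move=> /andP[/andP[ij jN] _]; apply: sm => //; lia.
rewrite add0r addr0 /slice subn0 drop0 take_size spellK => /eqP.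
by rewrite subr_eq0 => /eqP.
Qed.

End CrossingWords.

(** * The functional attached to a Rolli quasimorphism *)

Section RolliSums.
Variables (R : realType) (n : nat).
Local Notation F := (fgroup n).
Variable lam : 'I_n -> int -> R.
Implicit Types (f : F -> R) (l : seq ('I_n * int)) (g h x : F).

Definition syllables_word l : seq (letter n) := flatten (map (@syl_word n) l).

Fixpoint rolli_sum l f : R :=
  if l is p :: l' then
    lam p.1 p.2 *
      ((f (spell (syllables_word l)) + f (spell (syllables_word l'))) / 2)
    + rolli_sum l' f
  else 0.

Definition syllables_inv l := rev (map (fun p => (p.1, - p.2)) l).

Lemma syllables_word_cat l l' :
  syllables_word (l ++ l') = syllables_word l ++ syllables_word l'.
Proof. by rewrite /syllables_word map_cat flatten_cat. Qed.

Lemma syllables_word_inv l : syllables_word (syllables_inv l) = rinv (syllables_word l).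
Proof.
elim: l => // -[i m] l IH; rewrite /syllables_inv map_cons rev_cons -cats1.
rewrite syllables_word_cat -/(syllables_inv l) IH -(cat1s (i, m)).
rewrite syllables_word_cat rinv_cat; congr (_ ++ _).
rewrite /syllables_word /= !cats0 /syl_word /rinv /= map_nseq /= abszN.
have -> k (y : letter n) : rev (nseq k y) = nseq k y.
  by elim: k => // k IHk; rewrite -[in LHS]addn1 nseqD rev_cat IHk.
(* The exponent zero is apart because its sign bit does not flip; both words are then empty. *)
have [->|m0] := eqVneq m 0; first by [].
by rewrite /linv /= (_ : (- m < 0) = ~~ (m < 0)) //; move: m0; lia.
Qed.

Lemma rolli_sum_linear l c f f' : rolli_sum l (fun x => c * f x + f' x) =
  c * rolli_sum l f + rolli_sum l f'.
Proof. by elim: l => [|p l /= ->]; [rewrite /= mulr0 addr0 | field]. Qed.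

Lemma rolli_sum_cat l l' f : rolli_sum (l ++ l') f =
  rolli_sum l (fun x => f (x * spell (syllables_word l'))%g) + rolli_sum l' f.
Proof.
elim: l => [|p l /= ->]; first by rewrite add0r.
by rewrite addrA -!spell_cat -!syllables_word_cat.
Qed.

Lemma rolli_sum_inv l f : (forall i m, lam i (- m) = - lam i m) ->
  rolli_sum (syllables_inv l) f =
  - rolli_sum l (fun x => f (x * (spell (syllables_word l))^-1)%g).
Proof.
move=> odd; elim: l f => [|p l IH] f; first by rewrite /= oppr0.
have pE : syllables_inv [:: p] = [:: (p.1, - p.2)] by [].
rewrite /syllables_inv map_cons rev_cons -cats1 -/(syllables_inv l) -pE.
rewrite rolli_sum_cat IH syllables_word_inv spell_rinv.
have lE : spell (syllables_word (p :: l)) =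
    (spell (syllables_word [:: p]) * spell (syllables_word l))%g.
  by rewrite -spell_cat -syllables_word_cat.
rewrite [rolli_sum (p :: l) _]/= -/(syllables_word (p :: l)) lE !invgM.
rewrite [rolli_sum (syllables_inv _) _]/= odd -pE syllables_word_inv spell_rinv.
rewrite -/(syllables_word [::]) mulgA mulgK mulgV mulgA mulgV mul1g.
have -> : (fun x => f (x * (spell (syllables_word l))^-1 *
    (spell (syllables_word [:: p]))^-1)%g) = (fun x => f (x *
    ((spell (syllables_word l))^-1 * (spell (syllables_word [:: p]))^-1))%g).
  by apply/funext => x; rewrite mulgA.
have -> : spell (syllables_word [::]) = 1%g :> F by apply/val_inj.
by field.
Qed.

Definition syllabic l : bool :=
  all (fun p => p.2 != 0) l && sorted (fun p q => p.1 != q.1) l.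

Lemma syllables_syllabic g : syllabic (syllables g).
Proof. by have [_ a s] := syllablesP g; rewrite /syllabic a. Qed.

Lemma syllables_wordK g : syllables_word (syllables g) = g.
Proof. by have [] := syllablesP g. Qed.

Lemma word_syllablesK l : syllabic l -> syllables (syllables_word l) = l.
Proof.
elim: l => // -[i m] l IH /andP[/= /andP[m0 al] sl].
have {IH}lK : syllables (syllables_word l) = l.
  by apply: IH; rewrite /syllabic al (path_sorted sl).
have hd : if l is q :: _ then q.1 != i else true.
  by case: l sl {al lK} => //= q l /andP[]; rewrite eq_sym.
rewrite /syllables_word /= -/(syllables_word l) /syl_word /=.
(* The syllable is rebuilt letter by letter, by induction on [k], separately for each sign. *)
have [k mk] : exists k, m = (if m < 0 then - k.+1%:Z else k.+1%:Z).
  by exists `|m|%N.-1; case: ltrgt0P m0 => //; lia.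
have -> : `|m|%N = k.+1 by rewrite mk; case: ifP; lia.
rewrite [in RHS]mk; case: (m < 0) => /=; elim: k {mk} => [|k /= IHk] /=.
- by rewrite lK; case: l hd {lK al sl} => //= q l /negPf->.
- by rewrite IHk /= eqxx; congr ((_, _) :: _); rewrite /=; lia.
- by rewrite lK; case: l hd {lK al sl} => //= q l /negPf->.
by rewrite IHk /= eqxx; congr ((_, _) :: _); rewrite /=; lia.
Qed.

Lemma syl_word_add i (m m' : int) : m != 0 -> m' != 0 -> (m < 0) = (m' < 0) ->
  syl_word (i, m + m') = syl_word (i, m) ++ syl_word (i, m') :> seq (letter n).
Proof.
move=> m0 m'0 e; rewrite /syl_word /= -e.
have -> : (m + m' < 0) = (m < 0) by move: m0 m'0 e; lia.
by rewrite -nseqD; congr nseq; move: m0 m'0 e; lia.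
Qed.

(** Only the two syllables at the junction interact: if they share a generator, they merge into one,
    with exponents of equal sign as nothing cancels. *)
Lemma syllables_mul g h : word (g * h)%g = g ++ h ->
  syllables (g * h)%g = syllables g ++ syllables h \/
  exists l i m m' l',
    [/\ syllables g = rcons l (i, m), syllables h = (i, m') :: l',
        syllables (g * h)%g = l ++ (i, m + m') :: l' &
        syl_word (i, m + m') = syl_word (i, m) ++ syl_word (i, m') :> seq (letter n)].
Proof.
move=> gh; have := syllables_syllabic g; have := syllables_syllabic h.
have gE := syllables_wordK g; have hE := syllables_wordK h; rewrite gh.
have rgh : reduced (g ++ h) by rewrite -gh word_reduced.
case/lastP: (syllables g) gE => [|l [i m]] gE; case: (syllables h) hE => [|[i' m'] l'] hE.
- by left; rewrite -gE -hE.
- by move=> sh _; left; rewrite -gE -hE word_syllablesK.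
- by move=> _ sg; left; rewrite -gE -hE !cats0 word_syllablesK.
move=> /andP[/= /andP[m'0 al'] sl'] /andP[].
rewrite all_rcons /= => /andP[m0 al] sl.
have [ii'|ii'] := eqVneq i i'; last first.
  left; rewrite -gE -hE -syllables_word_cat word_syllablesK //.
  rewrite /syllabic all_cat all_rcons /= m0 al m'0 al' /= cat_rcons.
  rewrite -cat1s catA cats1.
  case: l sl {gE al} => [|q l] /=; first by rewrite ii' sl'.
  by rewrite cat_path rcons_path last_rcons /= => /andP[-> ->]; rewrite ii'.
subst i'; right.
have sgn : (m < 0) = (m' < 0).
  move: rgh; rewrite -gE -hE -cats1 syllables_word_cat /syllables_word /= cats0.
  rewrite /syl_word /= -catA => /cat_sorted2[_].
  have -> : `|m|%N = (`|m|%N.-1 + 1)%N by lia.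
  have -> : `|m'|%N = (`|m'|%N.-1).+1 by lia.
  rewrite nseqD -catA => /cat_sorted2[_] /= /andP[].
  by rewrite /linv xpair_eqE eqxx /=; do 2!case: (_ < 0).
have mm' := syl_word_add i m0 m'0 sgn.
exists l, i, m, m', l'; split=> //.
have -> : (g ++ h : seq _) = syllables_word (l ++ (i, m + m') :: l').
  rewrite -gE -hE -cats1 !syllables_word_cat -catA; congr (_ ++ _).
  by rewrite /syllables_word /= mm' cats0 catA.
apply: word_syllablesK; rewrite /syllabic all_cat /= al al' !andbT.
have -> : m + m' != 0 by move: m0 m'0 sgn; lia.
case: l sl {gE al} => [|q l] /=; first by move=> _; case: l' sl' {hE al'}.
rewrite cat_path rcons_path /= => /andP[-> ->] /=.
by case: l' sl' {hE al'}.
Qed.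

(** A reduced product merges at most one pair of syllables. The merged syllable and the two it
    replaces contribute at most [L * D] each, hence the factor 3. *)
Lemma rolli_quasi_cocycle L : 0 <= L -> (forall i m, lam i (- m) = - lam i m) ->
  (forall i m, `|lam i m| <= L) ->
  quasi_cocycle (fun g => rolli_sum (syllables g)) (3 * L).
Proof.
move=> L0 odd lamL; split=> [g c f f'|g f|g h f D gh fD].
- exact: rolli_sum_linear.
- have -> : syllables g^-1%g = syllables_inv (syllables g).
    rewrite wordV -{1}(syllables_wordK g) -syllables_word_inv word_syllablesK //.
    have /andP[ag sg] := syllables_syllabic g.
    rewrite /syllabic /syllables_inv all_rev all_map rev_sorted sorted_map.
    apply/andP; split; first by apply: sub_all ag => p /=; rewrite oppr_eq0.
    by apply: sub_sorted sg => p q /=; rewrite eq_sym.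
  by rewrite rolli_sum_inv // syllables_wordK spellK.
have avg_le (y z : R) : `|y| <= D -> `|z| <= D -> `|(y + z) / 2| <= D.
  rewrite !ler_norml => /andP[? ?] /andP[? ?]; apply/andP; split; lra.
have D0 : 0 <= D := le_trans (normr_ge0 _) (fD 1%g).
have term i m (y z : R) : `|y| <= D -> `|z| <= D ->
    `|lam i m * ((y + z) / 2)| <= L * D.
  by move=> yD zD; rewrite normrM ler_pM ?avg_le.
case: (syllables_mul gh) => [->|[l [i [m [m' [l' [gE hE ghE mm']]]]]]].
  rewrite rolli_sum_cat syllables_wordK spellK [X in `|X|](_ : _ = 0) ?normr0; last first.
    by ring.
  by rewrite !mulr_ge0.
rewrite ghE hE gE -cats1 !rolli_sum_cat.
have wE : (fun x => f (x * spell (syllables_word ((i, m + m') :: l')))%g) =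
    (fun x => f (x * spell (syllables_word [:: (i, m)]) * h)%g).
  apply/funext => x; rewrite -mulgA -[in RHS](spellK h) -(syllables_wordK h) hE.
  rewrite -spell_cat -syllables_word_cat; congr (f (x * spell _)%g).
  by rewrite /syllables_word /= mm' catA.
rewrite wE /= addr0.
set u := lam i (m + m') * _; set v := lam i m * _; set w := lam i m' * _.
rewrite [X in `|X|](_ : _ = u - v - w); last by ring.
have := term i (m + m') _ _ (fD (spell (syllables_word ((i, m + m') :: l'))))
  (fD (spell (syllables_word l'))).
have := term i m _ _ (fD (spell (syllables_word [:: (i, m)]) * h)%g)
  (fD (spell (syllables_word [::]) * h)%g).
have := term i m' _ _ (fD (spell (syllables_word ((i, m') :: l'))))
  (fD (spell (syllables_word l'))).
rewrite -/u -/v -/w; rewrite !ler_norml => /andP[? ?] /andP[? ?] /andP[? ?].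
apply/andP; split; lra.
Qed.

End RolliSums.

(** * Finiteness and comparison of the norms *)

Section CalegariQuasimorphisms.
Variables (R : realType) (n : nat).
Local Notation F := (fgroup n).
Implicit Types (a b : F -> R).

Lemma kappa_ge0 a k : (0 <= kappa a k)%E.
Proof.
apply: le_ereal_sup_tmp; exists (\esum_(w in set0) `|a w|%:E); last exact: esum_ge0.
exists set0; last by rewrite set0I.
by exists (inl [::]), (inl [::]); split=> // -[|? ?] [|? ?].
Qed.

Lemma kappa1_Skappa a : (kappa a 1 <= Skappa a)%E.
Proof.
(* The partial sum with two terms is [kappa a 0 + kappa a 1]. *)
apply: le_trans (nneseries_lim_ge 2 _) => [|k _ _]; last exact: kappa_ge0.
by rewrite !big_nat_recr //= big_geq // add0e leeDr ?kappa_ge0.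
Qed.

Lemma Cal_crossnorm a : coefficients a -> Cal (phi a) -> crossnorm a \is a fin_num.
Proof.
move=> ca [a' [ca' fin] /(phi_inj ca' ca) aE].
rewrite ge0_fin_numE ?crossnorm_ge0 //; apply: le_lt_trans fin; rewrite aE.
by apply: crossnorm_le => g m; exact: crossing_kappa.
Qed.

(** This is the additivity estimate for the constant function [1]. *)
Lemma phi_defect b g h : coefficients b -> crossnorm b \is a fin_num ->
  `|phi b g + phi b h - phi b (g * h)%g| <= 3 * fine (crossnorm b).
Proof.
move=> cb fin; rewrite !phiE // -normrN opprB opprD addrA.
have := quasi_cocycle_additive g h (brooks_quasi_cocycle (proj1 cb) fin)
  (f := fun=> 1) (D := 1) (fun=> _).
by rewrite mulr1; apply => _; rewrite normr1.
Qed.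

Lemma phi_brooks_sum a : coefficients a -> phi a = fun g => brooks_sum a g (fun=> 1).
Proof. by move=> ca; apply/funext => g; exact: phiE. Qed.

Lemma rolliE (lam : 'I_n -> int -> R) :
  rolli lam = fun g => rolli_sum lam (syllables g) (fun=> 1).
Proof.
apply/funext => g; rewrite /rolli; elim: syllables => [|p l IH]; first by rewrite big_nil.
by rewrite big_cons IH /=; field.
Qed.

Lemma rolli_norm_ge (lam : 'I_n -> int -> R) i : (supnorm (lam i) <= rolli_norm lam)%E.
Proof. exact: le_bigmax. Qed.

Lemma rolli_norm_fin (lam : 'I_n -> int -> R) : rolli_parameter lam ->
  rolli_norm lam \is a fin_num.
Proof.
move=> rlam; rewrite ge0_fin_numE ?bigmax_ge_id //; apply: bigmax_lt => // i _.
have [/bounded_funE[D lamD] _] := rlam i.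
apply: (@le_lt_trans _ _ D%:E); last exact: ltry.
by apply: ge_ereal_sup => _ [m _ <-]; rewrite lee_fin.
Qed.

End CalegariQuasimorphisms.

(** * Assembly of the five statements *)

Lemma le_norm_product (R : realType) (p A B X Y : \bar R) (c K : R) :
  A \is a fin_num -> B \is a fin_num -> (0 <= A <= X)%E -> (0 <= B <= Y)%E ->
  0 <= c <= K -> (p <= (c * (fine A * fine B))%:E)%E -> (p <= K%:E * (X * Y))%E.
Proof.
move=> Af Bf /andP[A0 AX] /andP[B0 BY] /andP[c0 cK] /le_trans; apply.
rewrite !EFinM !fineK //; apply: lee_pmul; rewrite ?lee_fin ?mule_ge0 //.
exact: lee_pmul.
Qed.

Theorem theorem4p19 (R : realType) :
  exists K : R, 0 < K /\
  forall (n : nat), (1 < n)%N ->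
  forall (alpha beta : fgroup n -> R) (lam : 'I_n -> int -> R),
  coefficients alpha -> coefficients beta ->
  Cal (phi alpha) -> Cal (phi beta) -> rolli_parameter lam ->
  [/\ forall I : set (fgroup n), symmetric_family I -> independent I ->
        supported alpha I -> supported beta I ->
        hcup (hclass (d1 (phi alpha))) (hclass (d1 (phi beta))) = hclass 0 /\
        exists p : cochain R (fgroup n) 3,
          [/\ bcochain p,
              coboundary p = cup (d1 (phi alpha)) (d1 (phi beta)) &
              (supnorm p <= K%:E * (supnorm alpha * supnorm beta))%E],
      l1_Ind (phi alpha) -> kappa_l1 (phi beta) ->
        hcup (hclass (d1 (phi alpha))) (hclass (d1 (phi beta))) = hclass 0 /\
        exists p : cochain R (fgroup n) 3,
          [/\ bcochain p,
              coboundary p = cup (d1 (phi alpha)) (d1 (phi beta)) &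
              (supnorm p <= K%:E * (SInd alpha * Skappa beta))%E],
      kappa_l1 (phi beta) ->
        hcup (hclass (d1 (rolli lam))) (hclass (d1 (phi beta))) = hclass 0 /\
        exists p : cochain R (fgroup n) 3,
          [/\ bcochain p,
              coboundary p = cup (d1 (rolli lam)) (d1 (phi beta)) &
              (supnorm p <= K%:E * (rolli_norm lam * Skappa beta))%E],
      l1_Ind (phi alpha) -> kappa_c0 (phi beta) ->
        gromov (hcup (hclass (d1 (phi alpha))) (hclass (d1 (phi beta)))) = 0%E &
      kappa_c0 (phi beta) ->
        gromov (hcup (hclass (d1 (rolli lam))) (hclass (d1 (phi beta)))) = 0%E].
Proof.
(* The primitive has norm at most [3 * M * D], with [D] three times the crossing norm of [beta]. For
   Brooks sums [M] is the crossing norm of [alpha], giving 9; for Rolli [M] is three times the norm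
   of [lam], giving 27. *)
exists 27; split=> // n _ alpha beta lam ca cb Ca Cb rlam.
have fa := Cal_crossnorm ca Ca; have fb := Cal_crossnorm cb Cb.
have a0 := crossnorm_ge0 alpha; have b0 := crossnorm_ge0 beta.
have SkE : (crossnorm beta <= Skappa beta)%E.
  apply: le_trans (kappa1_Skappa beta); apply: crossnorm_le => g m.
  exact: crossing_kappa.
have [hAB [p [bp dp pAB]]] := trivial_cup (brooks_quasi_cocycle (proj1 ca) fa)
  (fun g h => phi_defect g h cb fb).
have [L0 L1] : 0 <= fine (rolli_norm lam) /\
    forall i m, `|lam i m| <= fine (rolli_norm lam).
  split=> [|i m]; first by rewrite fine_ge0 ?bigmax_ge_id.
  rewrite -lee_fin fineK ?rolli_norm_fin //; apply: le_trans (rolli_norm_ge lam i).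
  by apply: ereal_sup_ubound; exists m.
have [hLB [q [bq dq qLB]]] := trivial_cup
  (rolli_quasi_cocycle L0 (fun i => proj2 (rlam i)) L1)
  (fun g h => phi_defect g h cb fb).
rewrite -phi_brooks_sum // in hAB dp; rewrite -rolliE in hLB dq.
have pXY X Y : (crossnorm alpha <= X)%E -> (crossnorm beta <= Y)%E ->
    (supnorm p <= 27%:E * (X * Y))%E.
  move=> aX bY; apply: (le_norm_product fa fb (c := 9)); rewrite ?a0 ?b0 //=.
    by rewrite ler0n ler_nat.
  by apply: le_trans pAB _; rewrite lee_fin le_eqVlt; apply/predU1P; left; ring.
split=> [I _ indI sa sb|_ _|_|_ _|_].
- split=> //; exists p; split=> //.
  by apply: pXY; apply: crossnorm_le => g m; apply: crossing_independent indI _.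
- split=> //; exists p; split=> //; apply: pXY => //.
  apply: le_ereal_inf_tmp => _ [b bdec <-]; apply: crossnorm_le => g m.
  exact: crossing_ind_decomposition.
- split=> //; exists q; split=> //.
  apply: (le_norm_product (rolli_norm_fin rlam) fb (c := 27));
    rewrite ?b0 ?lexx ?bigmax_ge_id ?ler0n //.
  by apply: le_trans qLB _; rewrite lee_fin le_eqVlt; apply/predU1P; left; ring.
(* The cup product is the class of [0], whose seminorm is zero. *)
- by rewrite hAB gromov_hclass0.
- by rewrite hLB gromov_hclass0.
Qed.
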